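(* Let $m\ge 2$ and $t\ge 1$ be integers and let $G$ be a graph. If $G$ contains the complete graph $K_t$ as a totally odd immersion, then the $m$-level generalised Mycielskian $\mu_m(G)$ contains $K_{t+1}$ as a totally odd immersion.
   Context: All graphs are finite, undirected and loopless. Given a graph $G$ and an integer $m\ge 2$, the $m$-level generalised Mycielskian $\mu_m(G)$ of $G$ is the graph with vertex set $(V(G)\times\{0,1,\dots,m-1\})\cup\{w\}$, where $w$ is a new vertex, and with the following edges: for every edge $uv\in E(G)$, the edge $(u,0)(v,0)$; for every edge $uv\in E(G)$ (in both orders of its endpoints) and every $i\in\{0,1,\dots,m-2\}$, the edge $(u,i)(v,i+1)$; and for every $u\in V(G)$, the edge $(u,m-1)w$. A graph $G$ contains a graph $H$ as a totally odd immersion if there are an injection $\varphi\colon V(H)\to V(G)$ and, for every edge $uv\in E(H)$, a path $P_{uv}$ in $G$ with endpoints $\varphi(u)$ and $\varphi(v)$ and of odd length (number of edges), such that the paths $P_{uv}$ ($uv\in E(H)$) are pairwise edge-disjoint and no vertex of $\varphi(V(H))$ (these vertices are called terminals) is an internal vertex of any of these paths. *)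

(* Defs.v *)
From HB Require Import structures.
From mathcomp Require Import all_boot.

Set Implicit Arguments.
Unset Strict Implicit.
Unset Printing Implicit Defensive.

(* Finite, undirected, loopless graphs. Edges form a type of their own, so      *)
(* parallel edges are allowed; the simple graphs are those with [ends]          *)
(* injective. Looplessness is the fact that an edge has exactly two endpoints.  *)
Record graph := Graph {
  vertex : finType;
  edge : finType;
  ends : edge -> {set vertex};
  card_ends : forall e, #|ends e| = 2
}.
Arguments ends {g} _.
Arguments card_ends {g} _.

Section Complete.
Variable t : nat.

Definition complete_edge : finType := {A : {set 'I_t} | #|A| == 2}.

Definition complete_ends (e : complete_edge) : {set 'I_t} := val e.

Lemma card_complete_ends e : #|complete_ends e| = 2.
Proof. exact/eqP/(valP e). Qed.

Definition complete : graph := Graph card_complete_ends.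

End Complete.

Section Paths.
Variable G : graph.

(* A walk is a start vertex together with its steps: [(e, v)] traverses the     *)
(* edge [e] and arrives at [v].                                                 *)
Definition walk : Type := (vertex G * seq (edge G * vertex G))%type.

Fixpoint valid_steps (x : vertex G) (s : seq (edge G * vertex G)) : bool :=
  if s is (e, y) :: s' then (ends e == [set x; y]) && valid_steps y s'
  else true.

Definition walk_start (p : walk) : vertex G := p.1.
Definition walk_vertices (p : walk) : seq (vertex G) := p.1 :: unzip2 p.2.
Definition walk_end (p : walk) : vertex G := last p.1 (unzip2 p.2).
Definition walk_edges (p : walk) : seq (edge G) := unzip1 p.2.
Definition walk_length (p : walk) : nat := size p.2.
Definition internal_vertices (p : walk) : seq (vertex G) :=
  behead (belast p.1 (unzip2 p.2)).

Definition is_path (p : walk) : bool :=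
  valid_steps p.1 p.2 && uniq (walk_vertices p).

End Paths.

Definition totally_odd_immersion (H G : graph) : Prop :=
  exists (phi : vertex H -> vertex G) (P : edge H -> walk G),
  [/\ injective phi,
      forall e : edge H,
        [/\ is_path (P e),
            [set walk_start (P e); walk_end (P e)] = phi @: ends e
          & odd (walk_length (P e))],
      forall e f : edge H, e != f ->
        [disjoint walk_edges (P e) & walk_edges (P f)]
    & forall (e : edge H) (v : vertex H), phi v \notin internal_vertices (P e)].

Section Mycielskian.
Variables (m : nat) (m_ge2 : 1 < m) (G : graph).

Definition level0 : 'I_m := Ordinal (ltnW m_ge2).

Lemma top_level_subproof : m.-1 < m.
Proof. by rewrite ltn_predL ltnW. Qed.
Definition top_level : 'I_m := Ordinal top_level_subproof.

Lemma low_level_subproof (i : 'I_m.-1) : i < m.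
Proof. exact: leq_trans (ltn_ord i) (leq_pred m). Qed.
Definition low_level (i : 'I_m.-1) : 'I_m := Ordinal (low_level_subproof i).

Lemma high_level_subproof (i : 'I_m.-1) : i.+1 < m.
Proof. by rewrite -ltn_predRL. Qed.
Definition high_level (i : 'I_m.-1) : 'I_m := Ordinal (high_level_subproof i).

(* [None] is the apex w. *)
Definition myc_vertex : finType := option (vertex G * 'I_m).

(* An edge of G with one of its two ends singled out, i.e. an edge uv taken in  *)
(* a given order (u, v), with u the distinguished end.                          *)
Definition dart : finType :=
  {d : edge G * vertex G | d.2 \in ends d.1}.

Definition myc_edge : finType := (edge G + dart * 'I_m.-1 + vertex G)%type.

Definition myc_ends (a : myc_edge) : {set myc_vertex} :=
  match a with
  | inl (inl e) => [set Some (v, level0) | v in ends e]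
  | inl (inr (d, i)) =>
      let: (e, u) := val d in
      Some (u, low_level i) |: [set Some (v, high_level i) | v in ends e :\ u]
  | inr u => [set Some (u, top_level); None]
  end.

Lemma card_myc_ends a : #|myc_ends a| = 2.
Proof.
have inj_lvl (j : 'I_m) : injective (fun v : vertex G => Some (v, j)).
  by move=> u v [].
case: a => [[e|[[[e u] /= ue] i]]|u] /=.
- by rewrite card_imset ?card_ends.
- have := card_ends e; rewrite (cardsD1 u) ue => -[]; rewrite add0n => card_v.
  rewrite cardsU1 card_imset // card_v.
  suff -> : Some (u, low_level i)
      \notin [set Some (v, high_level i) | v in ends e :\ u] by [].
  by apply/imsetP => -[v _ [_]] /eqP; rewrite ltn_eqF.
- by rewrite cards2.
Qed.

Definition mycielskian : graph := Graph card_myc_ends.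

End Mycielskian.

(* Main.v *)
Require Import Defs.
From mathcomp Require Import all_boot.

(** The terminals chosen for [K_{t+1}] are the copies, on the top level [m - 1],
    of the [t] terminals in [G], together with the apex [w].  The apex is joined
    to each top-level terminal by an edge, a path of length 1, so the work is to
    replace each path of the immersion in [G] by an odd path joining the top
    copies of its two ends.

    Such a lift exists on every level [j] ([exists_lift]), by induction on [j]
    over all odd paths [p] at once, from [x] to [y] say.  On level 0 it is the
    copy of [p].  On level [j + 1], step down from [(x, j + 1)] to the copy of a
    neighbour [a] of [x] on level [j], follow a lift on level [j] of an odd path
    from [a] to some [b], and step up from [(b, j)] to [(y, j + 1)].  Here the
    inner path is [p] without its first and last edges if [p] has at least three
    edges, and [p] reversed if [p] is a single edge ([odd_path_core]).  The
    length stays odd, and no vertex is repeated because the inner lift remains on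
    levels at most [j], whereas the two new vertices lie on level [j + 1].

    The lift of [p] uses only copies of edges and vertices of [p].  Hence lifts of
    edge-disjoint paths are edge-disjoint, and a top-level terminal met by
    a lift is the copy of a terminal on [p], so it is an end of the lift. *)

Set Implicit Arguments.
Unset Strict Implicit.
Unset Printing Implicit Defensive.

(** * Paths *)

Lemma valid_steps_rcons (G : graph) (x : vertex G) s e y :
  valid_steps x (rcons s (e, y)) =
  valid_steps x s && (ends e == [set last x (unzip2 s); y]).
Proof.
elim: s x => [|[f z] s IHs] x /=; first by rewrite andbT.
by rewrite IHs andbA.
Qed.

Lemma path_start_neq_end (G : graph) (p : walk G) :
  is_path p -> 0 < walk_length p -> walk_start p != walk_end p.
Proof.
case: p => x [//|[e y] s] /andP[_ /= /andP[x_notin _]] _.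
by apply: contraNneq x_notin => ->; rewrite /walk_end /= mem_last.
Qed.

Lemma mem_internal_path (G : graph) (p : walk G) v :
  is_path p -> v \in internal_vertices p ->
  [/\ v \in walk_vertices p, v != walk_start p & v != walk_end p].
Proof.
case: p => x s /andP[_].
rewrite /internal_vertices /walk_vertices /walk_start /walk_end /=.
case/lastP: (unzip2 s) => [//|r y]; rewrite belast_rcons last_rcons /=.
rewrite mem_rcons !inE negb_or rcons_uniq => /andP[/andP[_ x_r] /andP[y_r _]] v_r.
rewrite mem_rcons !inE v_r !orbT; split=> //.
  by apply: contraNneq x_r => <-.
by apply: contraNneq y_r => <-.
Qed.

Lemma internal_path (G : graph) (p : walk G) v :
  v \in walk_vertices p -> v != walk_start p -> v != walk_end p ->
  v \in internal_vertices p.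
Proof.
case: p => x s.
rewrite /internal_vertices /walk_vertices /walk_start /walk_end /=.
case/lastP: (unzip2 s) => [|r y]; first by rewrite inE => ->.
rewrite belast_rcons last_rcons /= inE mem_rcons inE.
by case: (v == x); case: (v == y).
Qed.

(** An odd path can be entered and left through edges at its ends so that an odd
    path [q] remains in between: drop the two end edges, or, for a single edge
    [xy], run [x y], then [q] = [y x], then [x y] again.  The edge is thus
    traversed three times, which is harmless when the three traversals are lifted
    to distinct copies of the edge. *)
Lemma odd_path_core (G : graph) (p : walk G) :
  is_path p -> odd (walk_length p) ->
  exists e f (q : walk G),
  [/\ e \in walk_edges p /\ f \in walk_edges p,
      ends e = [set walk_start p; walk_start q]
      /\ ends f = [set walk_end q; walk_end p],
      is_path q /\ odd (walk_length q),
      {subset walk_edges q <= walk_edges p}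
    & {subset walk_vertices q <= walk_vertices p}].
Proof.
case: p => x [//|[e a] s]; case/lastP: s => [|r [f y]].
  rewrite /is_path /= inE !andbT => /andP[/eqP eE xa] _.
  exists e, e, (a, [:: (e, x)]).
  rewrite /walk_edges /walk_vertices /is_path /= !inE !eqxx.
  split=> //; first by rewrite eE setUC eqxx eq_sym xa.
  by move=> v; rewrite !inE orbC.
rewrite /is_path /walk_vertices /walk_length /= size_rcons /= negbK.
rewrite valid_steps_rcons /unzip2 map_rcons /=.
move=> /andP[/and3P[/eqP eE r_ok /eqP fE] /andP[_]].
rewrite mem_rcons inE negb_or rcons_uniq.
move=> /andP[/andP[_ a_r] /andP[_ r_uniq]] r_odd.
exists e, f, (a, r); rewrite /walk_edges /walk_end /walk_vertices /=.
rewrite /unzip1 /unzip2 !map_rcons last_rcons /=.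
split=> //.
- by split; rewrite inE ?eqxx // mem_rcons mem_head orbT.
- by rewrite /is_path /= r_ok a_r.
- by move=> g gr; rewrite inE mem_rcons inE gr !orbT.
- by move=> v vr; rewrite inE -rcons_cons mem_rcons inE vr !orbT.
Qed.

(** * Lifting odd paths to a level of the Mycielskian *)

(** The edge of the base graph of which [a] is a copy or, for an edge to the apex,
    the vertex of the base graph below it. *)
Definition origin m (G : graph) (a : myc_edge m G) : edge G + vertex G :=
  match a with
  | inl (inl e) => inl e
  | inl (inr (d, _)) => inl (val d).1
  | inr u => inr u
  end.

Lemma level0_edge m (m_ge2 : 1 < m) (G : graph) (e : edge G) u v :
  ends e = [set u; v] ->
  @myc_ends m m_ge2 G (inl (inl e)) =
  [set Some (u, level0 m_ge2); Some (v, level0 m_ge2)].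
Proof. by move=> /= ->; rewrite imsetU1 imset_set1. Qed.

Lemma adjacent_levels_edge m (m_ge2 : 1 < m) (G : graph) (e : edge G) u v
    (i j : 'I_m) :
  ends e = [set u; v] -> j = i.+1 :> nat ->
  exists2 a : edge (mycielskian m_ge2 G),
    origin a = inl e & ends a = [set Some (u, i); Some (v, j)].
Proof.
move=> eE ji; have ue : u \in ends e by rewrite eE set21.
have i_low : i < m.-1 by rewrite -ltnS prednK ?(ltnW m_ge2) // -ji.
exists (inl (inr (exist _ (e, u) ue, Ordinal i_low))) => //=.
have -> : ends e :\ u = [set v].
  have := card_ends e; rewrite eE cards2; case: eqP => // /eqP uv _.
  by apply/setP=> x; rewrite !inE; case: (eqVneq x u) => // ->; apply/esym/negbTE.
rewrite imset_set1 /=.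
by congr [set Some (_, _); Some (_, _)]; apply: val_inj.
Qed.

(** The bound on the levels is the invariant that keeps the vertices distinct in
    the induction of [exists_lift]. *)
Definition lift_of m (m_ge2 : 1 < m) (G : graph) (j : 'I_m) (p : walk G)
    (q : walk (mycielskian m_ge2 G)) : Prop :=
  [/\ is_path q /\ odd (walk_length q),
      walk_start q = Some (walk_start p, j)
      /\ walk_end q = Some (walk_end p, j),
      {in walk_edges q, forall a,
        exists2 e, e \in walk_edges p & origin a = inl e}
    & {in walk_vertices q, forall v, exists y (i : 'I_m),
        [/\ v = Some (y, i), y \in walk_vertices p & i <= j]}].

Definition level0_walk m (m_ge2 : 1 < m) (G : graph) (p : walk G) :
    walk (mycielskian m_ge2 G) :=
  (Some (p.1, level0 m_ge2),
   [seq (inl (inl step.1), Some (step.2, level0 m_ge2)) | step <- p.2]).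

Lemma level0_lift m (m_ge2 : 1 < m) (G : graph) (p : walk G) :
  is_path p -> odd (walk_length p) ->
  lift_of (level0 m_ge2) p (level0_walk m_ge2 p).
Proof.
case: p => x s p_path p_odd.
pose h (v : vertex G) : vertex (mycielskian m_ge2 G) := Some (v, level0 m_ge2).
have vtxE : unzip2 (level0_walk m_ge2 (x, s)).2 = map h (unzip2 s).
  by rewrite /unzip2 /= -!map_comp.
have verticesE : walk_vertices (level0_walk m_ge2 (x, s)) = map h (x :: unzip2 s).
  by rewrite /walk_vertices vtxE.
case/andP: p_path => s_ok s_uniq.
split.
- rewrite /is_path verticesE map_inj_uniq; last by move=> u v [].
  rewrite s_uniq andbT /walk_length size_map; split=> //=.
  elim: s x s_ok {s_uniq vtxE verticesE p_odd} => //= [[e y] s] IHs x /=.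
  by move=> /andP[/eqP eE /IHs ->]; rewrite -(level0_edge m_ge2 eE) eqxx.
- by split=> //; rewrite /walk_end vtxE -[(level0_walk _ _).1]/(h x) last_map.
- move=> a /mapP[_ /mapP[[e y] ey_s ->] ->] /=.
  by exists e => //; apply: (map_f (fun step => step.1) ey_s).
- move=> v; rewrite verticesE => /mapP[y y_s ->].
  by exists y, (level0 m_ge2).
Qed.

Lemma exists_lift m (m_ge2 : 1 < m) (G : graph) (j : 'I_m) (p : walk G) :
  is_path p -> odd (walk_length p) ->
  exists q : walk (mycielskian m_ge2 G), lift_of j p q.
Proof.
move: {-2}(nat_of_ord j) (erefl (nat_of_ord j)) => L.
elim: L j p => [|L IHL] j p Lj p_path p_odd.
  have -> : j = level0 m_ge2 by apply: val_inj.
  by exists (level0_walk m_ge2 p); apply: level0_lift.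
have iP : L < m by rewrite (ltn_trans _ (ltn_ord j)) // -Lj.
pose i := Ordinal iP; have ji : j = i.+1 :> nat by rewrite -Lj.
have [e [f [p' [[e_p f_p] [eE fE] [p'_path p'_odd] edges_p' vertices_p']]]] :=
  odd_path_core p_path p_odd.
have [[z s] [[/andP[/= s_ok s_uniq] s_odd] [/= startE endE] edges_s vertices_s]] :=
  IHL i p' erefl p'_path p'_odd.
have [a aO aE] : exists2 a : edge (mycielskian m_ge2 G), origin a = inl e
    & ends a = [set Some (walk_start p', i); Some (walk_start p, j)].
  by apply: adjacent_levels_edge; rewrite // setUC.
have [b bO bE] : exists2 b : edge (mycielskian m_ge2 G), origin b = inl f
    & ends b = [set Some (walk_end p', i); Some (walk_end p, j)].
  exact: adjacent_levels_edge.
pose x' : vertex (mycielskian m_ge2 G) := Some (walk_start p, j).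
pose y' : vertex (mycielskian m_ge2 G) := Some (walk_end p, j).
have not_below u : Some (u, j) \notin z :: unzip2 s.
  apply/negP=> /vertices_s[y [k [[_ <-] _]]].
  by rewrite ji ltnn.
have x'y' : x' != y'.
  apply: contraNneq (path_start_neq_end p_path (odd_gt0 p_odd)).
  by case=> ->.
have verticesE :
    walk_vertices ((x', (a, z) :: rcons s (b, y')) : walk (mycielskian m_ge2 G))
    = x' :: rcons (z :: unzip2 s) y'.
  by rewrite /walk_vertices /unzip2 /= map_rcons.
exists (x', (a, z) :: rcons s (b, y')); split.
- split; last by rewrite /walk_length /= size_rcons /= negbK.
  apply/andP; split.
    have zE : z = Some (walk_start p', i) := startE.
    have sE : last z (unzip2 s) = Some (walk_end p', i) := endE.
    move: aE bE; rewrite /= valid_steps_rcons /= => -> ->.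
    by rewrite s_ok sE zE setUC !eqxx.
  rewrite verticesE cons_uniq rcons_uniq mem_rcons in_cons negb_or x'y'.
  by rewrite !not_below; exact: s_uniq.
- by split=> //; rewrite /walk_end /unzip2 /= map_rcons last_rcons.
- move=> c; rewrite /walk_edges /unzip1 /= map_rcons inE mem_rcons inE.
  case/or3P=> [/eqP->|/eqP->|/edges_s[g /edges_p' g_p gE]].
  + by exists e.
  + by exists f.
  + by exists g.
- move=> v; rewrite verticesE inE mem_rcons inE.
  case/or3P=> [/eqP->|/eqP->|/vertices_s[y [k [-> /vertices_p' y_p kL]]]].
  + by exists (walk_start p), j; split=> //; apply: mem_head.
  + by exists (walk_end p), j; split=> //; apply: mem_last.
  + by exists y, k; split=> //; rewrite ji (leq_trans kL).
Qed.

(** * Complete graphs with one more vertex *)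

(** The vertex added to [K_t] is [ord0], so that [lift ord0] embeds the old
    vertices among the new ones. *)
Lemma complete_edge_cases t (A : edge (complete t.+1)) :
  (exists i : 'I_t, ends A = [set ord0; lift ord0 i])
  \/ (exists B : edge (complete t), ends A = lift ord0 @: ends B).
Proof.
have [A0|A0] := boolP (ord0 \in ends A); [left | right].
  have /eqP := card_ends A; rewrite (cardsD1 ord0) A0 eqSS => /cards1P[k kE].
  have: k \in ends A :\ ord0 by rewrite kE set11.
  rewrite !inE eq_sym => /andP[k0 _].
  have [i ki _] := unlift_some k0.
  by exists i; rewrite -ki -kE setD1K.
have AE : ends A = lift ord0 @: (lift ord0 @^-1: ends A).
  apply/setP=> k; apply/idP/imsetP=> [kA|[i]]; last by rewrite inE => iA ->.
  have k0 : ord0 != k by apply: contraNneq A0 => ->.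
  have [i ki _] := unlift_some k0.
  by exists i; rewrite // inE -ki.
have B2 : #|lift ord0 @^-1: ends A| == 2.
  by rewrite -(card_ends A) {2}AE card_imset //; apply: lift_inj.
by exists (Sub (lift ord0 @^-1: ends A) B2 : complete_edge t).
Qed.

Section Extension.
Variables (m t : nat) (m_ge2 : 1 < m) (G : graph).
Variable phi : vertex (complete t) -> vertex G.

Definition extended_terminal (k : vertex (complete t.+1)) :
    vertex (mycielskian m_ge2 G) :=
  if unlift ord0 k is Some i then Some (phi i, top_level m_ge2) else None.

Lemma extended_terminal0 : extended_terminal ord0 = None.
Proof. by rewrite /extended_terminal unlift_none. Qed.

Lemma extended_terminal_lift i :
  extended_terminal (lift ord0 i) = Some (phi i, top_level m_ge2).
Proof. by rewrite /extended_terminal liftK. Qed.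

Lemma extended_terminal_inj : injective phi -> injective extended_terminal.
Proof.
move=> phi_inj k l; rewrite /extended_terminal.
by case: unliftP => [i ->|->]; case: unliftP => [h ->|->] // [/phi_inj ->].
Qed.

Definition apex_walk (i : 'I_t) : walk (mycielskian m_ge2 G) :=
  (Some (phi i, top_level m_ge2), [:: (inr (phi i), None)]).

Lemma lift_avoids_terminals (p : walk G) (q : walk (mycielskian m_ge2 G)) k :
  (forall i, phi i \notin internal_vertices p) ->
  lift_of (top_level m_ge2) p q ->
  extended_terminal k \notin internal_vertices q.
Proof.
move=> avoid [[q_path _] [startE endE] _ vertices_q].
apply/negP=> /(mem_internal_path q_path)[/vertices_q[y [l [kE y_p _]]]].
rewrite startE endE; move: kE; rewrite /extended_terminal.
case: unlift => // i [phi_i _] start_i end_i.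
have /negP := avoid i; apply; apply: internal_path; first by rewrite phi_i.
  by apply: contraNneq start_i => ->.
by apply: contraNneq end_i => ->.
Qed.

(** The paths admitted here for [A] are described by where their edges come from:
    if [phi] is injective and the paths [P] are edge-disjoint, the origin of any
    one of these edges determines [A], so that paths for different [A] are
    edge-disjoint too. *)
Definition path_for (P : edge (complete t) -> walk G) (A : edge (complete t.+1))
    (q : walk (mycielskian m_ge2 G)) : Prop :=
  (exists2 i : 'I_t, ends A = [set ord0; lift ord0 i] & q = apex_walk i)
  \/ (exists2 B : edge (complete t), ends A = lift ord0 @: ends B
      & lift_of (top_level m_ge2) (P B) q).

Lemma path_for_disjoint P A B q r :
  injective phi ->
  (forall e f, e != f -> [disjoint walk_edges (P e) & walk_edges (P f)]) ->
  path_for P A q -> path_for P B r -> A != B ->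
  [disjoint walk_edges q & walk_edges r].
Proof.
move=> phi_inj P_disj Aq Br; apply: contraNT => /pred0Pn[a /andP[/= aq ar]].
apply/eqP/val_inj; change (ends A = ends B).
case: Aq aq => [[i AE ->]|[A' AE [_ _ origin_q _]]] aq;
  case: Br ar => [[j BE ->]|[B' BE [_ _ origin_r _]]] ar.
- move: aq ar; rewrite !inE => /eqP-> /eqP[/phi_inj ij].
  by rewrite AE BE ij.
- by have [e _] := origin_r _ ar; move: aq; rewrite inE => /eqP->.
- by have [e _] := origin_q _ aq; move: ar; rewrite inE => /eqP->.
- have [f f_B fE] := origin_r _ ar; have [e e_A] := origin_q _ aq.
  rewrite fE => -[fe]; suff A'B' : A' = B' by rewrite AE BE A'B'.
  by apply: contraTeq e_A => /P_disj/disjointFl ->; rewrite -?fe.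
Qed.

End Extension.

Theorem theorem1p7 (m t : nat) (m_ge2 : 1 < m) (t_ge1 : 0 < t) (G : graph) :
  totally_odd_immersion (complete t) G ->
  totally_odd_immersion (complete t.+1) (mycielskian m_ge2 G).
Proof.
move=> [phi [P [phi_inj P_ok P_disj P_avoid]]].
have [Q Q_ok] : exists Q : edge (complete t.+1) -> walk (mycielskian m_ge2 G),
    forall A, path_for phi P A (Q A).
  apply: fin_all_exists => A.
  case: (complete_edge_cases A) => [[i AE]|[B AE]].
    by exists (apex_walk m_ge2 phi i); left; exists i.
  have [B_path _ B_odd] := P_ok B.
  have [q q_lift] := exists_lift m_ge2 (top_level m_ge2) B_path B_odd.
  by exists q; right; exists B.
exists (extended_terminal m_ge2 phi), Q; split.
- exact: extended_terminal_inj.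
- move=> A; case: (Q_ok A) => [[i AE ->]|[B AE [[q_path q_odd] [-> ->] _ _]]].
    split=> //; first by rewrite /is_path /= !eqxx.
    rewrite AE imsetU1 imset_set1 extended_terminal0 extended_terminal_lift.
    by rewrite setUC.
  split=> //; have [_ B_ends _] := P_ok B.
  rewrite AE -imset_comp (eq_imset _ (extended_terminal_lift m_ge2 phi)).
  rewrite (imset_comp (fun v => Some (v, top_level m_ge2)) phi) -B_ends.
  by rewrite imsetU1 imset_set1.
- by move=> A B; apply: (path_for_disjoint phi_inj P_disj).
- move=> A k; case: (Q_ok A) => [[i _ ->] //|[B _ q_lift]].
  exact: lift_avoids_terminals q_lift.
Qed.
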